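(* Let $m\ge 1$ and $t\ge 0$ be integers, and let $F(x)=\sum_{j=0}^{t} f_j x^j$ be a polynomial with coefficients $f_j\in GF(2^m)$, where by convention $f_i=0$ for all $i>t$. Then $$F(x)=f_3x^3+\sum_{i=0}^{\lceil (t-4)/5\rceil} x^{5i}\Bigl(f_{5i}+\sum_{j=0}^{3} f_{5i+2^j}\,x^{2^j}\Bigr).$$
   Context: $GF(2^m)$ is the finite field with $2^m$ elements. For a real number $a$, $\lceil a\rceil$ denotes the smallest integer greater than or equal to $a$. The equality is an identity of polynomials in $x$ over $GF(2^m)$. *)

(* Defs.v *)
From HB Require Import structures.
From mathcomp Require Import all_boot all_order all_algebra.

Set Implicit Arguments.
Unset Strict Implicit.
Unset Printing Implicit Defensive.

Import Order.TTheory GRing.Theory Num.Theory.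

Local Open Scope ring_scope.

(* The ceiling is an int; it is nonnegative for every t >= 0 (its value at     *)
(* t = 0 is ceil(-4/5) = 0), so the absolute value is only a cast to nat.      *)
Definition upper_index (t : nat) : nat :=
  `|Num.ceil ((t%:R - 4%:R) / 5%:R : rat)|%N.

Lemma upper_indexE (t : nat) :
  (upper_index t)%:Z = Num.ceil ((t%:R - 4%:R) / 5%:R : rat).
Proof.
rewrite /upper_index gez0_abs // ceil_ge0.
apply: (@lt_le_trans _ _ (- 4%:R / 5%:R)) => //.
by rewrite ler_pM2r // lerDr ler0n.
Qed.

(* Main.v *)
(** The exponents [5 i + {0, 1, 2, 4, 8}] for [i <= n] cover each residue class
    modulo 5 once per block, except that [5 i + 8 = 5 (i + 1) + 3] represents
    the class of 3 one block late. Hence [x^3] has to be added separately, and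
    the only surplus exponent is [5 n + 8], which exceeds [t] as soon as
    [t <= 5 n + 4]. *)
Require Import Defs.
From HB Require Import structures.
From mathcomp Require Import all_boot all_order all_algebra.
From mathcomp Require Import zify.

Set Implicit Arguments.
Unset Strict Implicit.
Unset Printing Implicit Defensive.

Import Order.TTheory GRing.Theory Num.Theory.

Local Open Scope ring_scope.

(** A ceiling is at least its argument; clear the denominator. Keeping the 4 on the right avoids
    truncated subtraction. *)
Lemma leq_upper_index (t : nat) : (t <= 5 * upper_index t + 4)%N.
Proof.
have /(_ ((t%:R - 4%:R) / 5%:R : rat)) := @Num.Theory.ceil_ge rat.
rewrite -upper_indexE -pmulrn ler_pdivrMr ?ltr0n // lerBlDr.
by rewrite -natrM -natrD ler_nat mulnC.
Qed.

(** Induction with [g (5 * n + 3)] as a carry: block [n] skips this index, the carry fills it, and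
    the last term of the block is the next carry. The initial carry is [g 3]. *)
Lemma sum_blocks5 (V : nmodType) (g : nat -> V) (n : nat) :
  \sum_(0 <= k < 5 * n) g k + g (5 * n + 3)%N =
  g 3%N + \sum_(0 <= i < n)
            (g (5 * i)%N + \sum_(0 <= j < 4) g (5 * i + 2 ^ j)%N).
Proof.
elim: n => [|n IHn]; first by rewrite muln0 !big_geq // add0r addr0.
rewrite [in RHS]big_nat_recr //= addrA -IHn.
(* The index 5n + 8 is put in the form of the next carry. *)
have -> : \sum_(0 <= j < 4) g (5 * n + 2 ^ j)%N =
          g (5 * n).+1 + g (5 * n).+2 + g (5 * n).+4 + g (5 * n.+1 + 3)%N.
  rewrite unlock /= addr0 !addrA.
  by congr (g _ + g _ + g _ + g _); lia.
have -> : (5 * n.+1 = (5 * n).+4.+1)%N by lia.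
rewrite !big_nat_recr //= !addn3 -!addrA; congr (_ + _).
(* The old carry moves past the three terms of smaller index. *)
rewrite [RHS]addrCA; congr (_ + _); rewrite [RHS]addrCA; congr (_ + _).
by rewrite [RHS]addrCA.
Qed.

Theorem mainTheorem1 (m t : nat) (hm : (1 <= m)%N)
    (K : finFieldType) (hK : #|K| = (2 ^ m)%N)
    (f : nat -> K) (hf : forall i : nat, (t < i)%N -> f i = 0)
    (F : {poly K}) (hF : F = \sum_(0 <= j < t.+1) f j *: 'X^j) :
  F = f 3%N *: 'X^3 +
      \sum_(0 <= i < (upper_index t).+1)
         'X^(5 * i) *
         ((f (5 * i)%N)%:P +
          \sum_(0 <= j < 4) f (5 * i + 2 ^ j)%N *: 'X^(2 ^ j)).
Proof.
have le_t := leq_upper_index t; set n := upper_index t in le_t *.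
pose g k : {poly K} := f k *: 'X^k.
have g0 k : (t < k)%N -> g k = 0 by move=> /hf fk0; rewrite /g fk0 scale0r.
transitivity (\sum_(0 <= k < 5 * n.+1) g k + g (5 * n.+1 + 3)%N).
  rewrite hF (g0 (5 * n.+1 + 3)%N); last by lia.
  (* Cutting at t + 1 requires t + 1 <= 5(n + 1), which is [le_t]. *)
  rewrite addr0 (@big_cat_nat _ _ _ t.+1 0 (5 * n.+1)) //=; last by lia.
  by rewrite [X in _ + X]big_nat [X in _ + X]big1 ?addr0 // => k /andP[/g0].
rewrite sum_blocks5; congr (_ + _); apply: eq_bigr => i _.
rewrite mulrDr mulr_sumr; congr (_ + _); first by rewrite /g mulrC mul_polyC.
by apply: eq_bigr => j _; rewrite /g -scalerAr -exprD.
Qed.
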